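(* Let $\Phi$ be a root system with Weyl group $W$ (with a fixed choice of simple roots), let $w\in W$ and $\beta\in\operatorname{inv}(w)$. Then the following are equivalent: (1) $\beta$ is a non-Bruhat inversion of $w$. (2) There exists $a_\gamma\in\mathbb{R}_{\ge 0}$ for each $\gamma\in\operatorname{inv}(w)$ such that $\beta=\sum_{\gamma\in\operatorname{inv}(w)}a_\gamma\gamma$ and such that this expression is not $\beta=1\cdot\beta$, that is, there exists some $\gamma\in\operatorname{inv}(w)$ with $a_\gamma\neq\delta_{\beta,\gamma}$, where $\delta$ is the Kronecker delta. (3) There exist $\gamma_1,\gamma_2\in\operatorname{inv}(w)$ with $\gamma_1\neq\gamma_2$ and $a_1,a_2\in\mathbb{R}_{>0}$ such that $\beta=a_1\gamma_1+a_2\gamma_2$. (4) There exist $\gamma_1,\gamma_2\in\operatorname{inv}(w)$ with $\gamma_1\neq\gamma_2$ and $n\in\{1,2,3\}$ such that $\beta=(\gamma_1+\gamma_2)/n$. Moreover, if $\Phi$ is simply-laced, then each of the conditions (1), (2), (3) and (4) is equivalent to: (5) There exist $\gamma_1,\gamma_2\in\operatorname{inv}(w)$ satisfying $\beta=\gamma_1+\gamma_2$.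
   Context: Let $V$ be a Euclidean space with inner product $(-,-)$; for $\alpha\neq0$ put $\langle\beta,\alpha\rangle=2(\beta,\alpha)/(\alpha,\alpha)$ and $t_\alpha(\beta)=\beta-\langle\beta,\alpha\rangle\alpha$. A root system $\Phi\subset V$ is a finite spanning subset not containing $0$ with $\Phi\cap\mathbb{R}\alpha=\{\pm\alpha\}$, $t_\alpha(\Phi)=\Phi$ and $\langle\beta,\alpha\rangle\in\mathbb{Z}$ for all $\alpha,\beta\in\Phi$. It is simply-laced if $\langle\alpha,\beta\rangle=\langle\beta,\alpha\rangle$ for all $\alpha,\beta\in\Phi$. Fix simple roots; $\Phi^+,\Phi^-$ are the corresponding positive and negative roots. $W\subset GL(V)$ is the Weyl group generated by all $t_\alpha$, $\alpha\in\Phi$, and $\ell$ is the length function with respect to simple reflections. For $w\in W$, $\operatorname{inv}(w)=\Phi^+\cap w(\Phi^-)$ is the set of inversions of $w$. A positive root $\beta$ is a Bruhat inversion of $w$ if $\ell(t_\beta w)=\ell(w)-1$. A non-Bruhat inversion of $w$ is an element of $\operatorname{inv}(w)$ which is not a Bruhat inversion of $w$. *)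

(* Defs.v *)
From HB Require Import structures.
From mathcomp Require Import all_boot all_order all_algebra finmap.
From mathcomp Require Import boolp classical_sets reals.

Set Implicit Arguments.
Unset Strict Implicit.
Unset Printing Implicit Defensive.

Import Order.TTheory GRing.Theory Num.Theory.

Local Open Scope fset_scope.
Local Open Scope ring_scope.

Section RootSystems.
Variables (R : realType) (V : vectType R) (ip : {dot V for idfun}).

(* <b, a> = 2 (b, a) / (a, a) *)
Definition pairing (b a : V) : R := 2 * ip b a / ip a a.

Definition reflection_fun (a b : V) : V := b - pairing b a *: a.

Lemma reflection_fun_is_linear a : linear (reflection_fun a).
Proof.
move=> k x y; rewrite /reflection_fun /pairing linearPl.
rewrite mulrDr mulrDl scalerDl scalerBr scalerA /=.
by rewrite mulrCA -!mulrA opprD addrACA.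
Qed.

HB.instance Definition _ a :=
  GRing.isLinear.Build R V V *:%R (reflection_fun a)
    (reflection_fun_is_linear a).

Definition reflection (a : V) : 'End(V) := linfun (reflection_fun a).

Lemma reflectionE a b : reflection a b = b - pairing b a *: a.
Proof. exact: lfunE. Qed.

Record root_system (Phi : {fset V}) : Prop := RootSystem {
  root_span : (<<enum_fset Phi>> = fullv)%VS;
  root_neq0 : 0 \notin Phi;
  root_line : forall a, a \in Phi -> forall b,
    (b \in Phi /\ exists c : R, b = c *: a) <-> (b = a \/ b = - a);
  root_refl : forall a, a \in Phi -> [fset reflection a b | b in Phi] = Phi;
  root_int : forall a b, a \in Phi -> b \in Phi -> pairing b a \is a Num.int
}.

Definition simply_laced (Phi : {fset V}) : Prop :=
  forall a b, a \in Phi -> b \in Phi -> pairing a b = pairing b a.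

Inductive weyl_group (Phi : {fset V}) : 'End(V) -> Prop :=
| weyl_id : weyl_group Phi \1%VF
| weyl_refl a of a \in Phi : weyl_group Phi (reflection a)
| weyl_comp f g of weyl_group Phi f & weyl_group Phi g :
    weyl_group Phi (f \o g)%VF
| weyl_inv f of weyl_group Phi f : weyl_group Phi (f^-1)%VF.

Section SimpleRoots.
Variables (Phi : {fset V}) (n : nat) (Delta : n.-tuple V).

Record simple_roots : Prop := SimpleRoots {
  simple_sub : {subset Delta <= Phi};
  simple_basis : basis_of fullv Delta;
  simple_coord : forall b, b \in Phi ->
    (forall i, coord Delta i b \is a Num.nat) \/
    (forall i, - coord Delta i b \is a Num.nat)
}.

Definition positive_roots : {fset V} :=
  [fset b in Phi | [forall i, 0 <= coord Delta i b]].

Definition negative_roots : {fset V} :=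
  [fset b in Phi | [forall i, coord Delta i b <= 0]].

Definition word_prod (s : seq V) : 'End(V) :=
  foldr (fun a f => (reflection a \o f)%VF) \1%VF s.

Definition simple_word (w : 'End(V)) (s : seq V) : Prop :=
  {subset s <= Delta} /\ w = word_prod s.

(* The default value 0 of xget is only reached when w is not a product of
   simple reflections, which does not happen on the Weyl group. *)
Definition length (w : 'End(V)) : nat :=
  xget 0%N [set k | (exists2 s, simple_word w s & size s = k) /\
                    (forall s, simple_word w s -> (k <= size s)%N)]%classic.

Definition inversions (w : 'End(V)) : {fset V} :=
  positive_roots `&` [fset w b | b in negative_roots].

(* l(t_b w) = l(w) - 1, written without truncated subtraction *)
Definition Bruhat_inversion (w : 'End(V)) (b : V) : Prop :=
  b \in positive_roots /\ (length (reflection b \o w)%VF).+1 = length w.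

Definition non_Bruhat_inversion (w : 'End(V)) (b : V) : Prop :=
  b \in inversions w /\ ~ Bruhat_inversion w b.

End SimpleRoots.
End RootSystems.

(* Main.v *)
Require Import Defs.
From mathcomp Require Import all_boot all_order all_algebra finmap reals.
From mathcomp Require Import boolp classical_sets ring lra.

(* Write t for the reflection in beta.  The length of w is |inv(w)|, and
   sending x to t(x) when t(x) > 0 and to x otherwise injects inv(t w) into
   inv(w) minus beta, with image the roots x such that t(x) > 0 or
   w^-1(t(x)) < 0.  So beta is Bruhat iff every other inversion x satisfies
   this dichotomy.  If some x fails it, then x and -t(x) are inversions whose
   sum is <x, beta> beta, with <x, beta> in {1, 2, 3} by strict Cauchy-Schwarz.
   Conversely, if all satisfy it, write each inversion as x = p + c beta with
   p = t(x) or p = x, so that p > 0 and w^-1(t(p)) < 0.  A relation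
   beta = sum a x becomes C beta = sum a p; positivity gives C >= 0, and
   applying w^-1 t gives C <= 0, so every p-coefficient vanishes. *)

Set Implicit Arguments.
Unset Strict Implicit.
Unset Printing Implicit Defensive.

Import Order.TTheory GRing.Theory Num.Theory.
Local Open Scope ring_scope.

(** * Reflections in a Euclidean space *)

Section Reflections.
Variables (R : realType) (V : vectType R) (ip : {dot V for idfun}).
Implicit Types a b x y : V.

Local Notation "<< b , a >>" := (pairing ip b a).
Local Notation t := (reflection ip).

Lemma ipC x y : ip x y = ip y x.
Proof. by rewrite hermC expr0 mul1r. Qed.

Lemma ip_gt0 x : x != 0 -> 0 < ip x x.
Proof. exact: neq0_dnorm_gt0. Qed.

Lemma pairing_gt0 a b : a != 0 -> (0 < << b, a >>) = (0 < ip b a).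
Proof. by move=> a0; rewrite pmulr_lgt0 ?invr_gt0 ?ip_gt0 // pmulr_rgt0. Qed.

Lemma pairing_gt0C a b : a != 0 -> b != 0 -> (0 < << b, a >>) = (0 < << a, b >>).
Proof. by move=> a0 b0; rewrite !pairing_gt0 // ipC. Qed.

Lemma pairing_self a : a != 0 -> << a, a >> = 2.
Proof. by move=> a0; rewrite /pairing mulfK // gt_eqF ?ip_gt0. Qed.

Lemma reflection_self a : a != 0 -> t a a = - a.
Proof.
by move=> a0; rewrite reflectionE pairing_self // scaler_nat mulr2n opprD addNKr.
Qed.

Lemma reflectionK a : a != 0 -> involutive (t a).
Proof.
move=> a0 x; rewrite [t a x]reflectionE linearB linearZ /= reflection_self //.
by rewrite reflectionE scalerN opprK subrK.
Qed.

Lemma reflection_comp a : a != 0 -> (t a \o t a = \1)%VF.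
Proof. by move=> a0; apply/lfunP => x; rewrite comp_lfunE id_lfunE reflectionK. Qed.

Lemma ip_reflection a x y : a != 0 -> ip (t a x) (t a y) = ip x y.
Proof.
move=> a0; have := ip_gt0 a0 => /lt0r_neq0 aa.
rewrite !reflectionE linearBl !linearBr !linearZl_LR !linearZr_LR /=.
rewrite /pairing (ipC a y); field; exact: aa.
Qed.

(** Lets an argument about [t b] descend to the reflection in the root [t a b]; both the exchange
    property and the generation of the Weyl group by simple reflections rest on it. *)
Lemma reflection_conj a b : a != 0 -> (t a \o t b \o t a = t (t a b))%VF.
Proof.
move=> a0; apply/lfunP => x; rewrite !comp_lfunE [RHS]reflectionE /pairing.
rewrite ip_reflection // -(ip_reflection x _ a0) reflectionK //.
by rewrite [t b _]reflectionE linearB linearZ /= reflectionK.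
Qed.

Lemma strict_Cauchy_Schwarz a b : a != 0 -> b != 0 ->
  (forall c, b != c *: a) -> << a, b >> * << b, a >> < 4.
Proof.
(* [b - k *: a] is the component of [b] orthogonal to [a]; it is nonzero, and its squared norm
   contains the factor 1 minus a quarter of the product of the pairings. *)
move=> a0 b0 ncol; pose k := << b, a >> / 2.
have h : 0 < ip (b - k *: a) (b - k *: a) by rewrite ip_gt0 // subr_eq0.
have aa := ip_gt0 a0; have bb := ip_gt0 b0.
have E : ip (b - k *: a) (b - k *: a) = ip b b * (1 - << a, b >> * << b, a >> / 4).
  rewrite linearBl !linearBr !linearZl_LR !linearZr_LR /= /k /pairing (ipC a b).
  by field; rewrite !gt_eqF.
by move: h; rewrite E pmulr_rgt0 // => h; lra.
Qed.

End Reflections.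

(** * The cone spanned by the simple roots *)

Section RootSystem.
Variables (R : realType) (V : vectType R) (ip : {dot V for idfun}).
Variables (Phi : {fset V}) (n : nat) (Delta : n.-tuple V).
Hypotheses (hPhi : root_system ip Phi) (hDelta : simple_roots Phi Delta).
Implicit Types (a b x y : V) (f w : 'End(V)) (s : seq V).

Local Notation "<< b , a >>" := (pairing ip b a).
Local Notation t := (reflection ip).
Local Notation N := (inversions Phi Delta).

(** Positivity is tested on arbitrary vectors, not only roots, because the argument adds and
    rescales inversions; negativity of [x] is written [nneg (- x)]. *)
Definition nneg x := [forall i, 0 <= coord Delta i x].

Lemma nneg0 : nneg 0.
Proof. by apply/forallP => i; rewrite linear0. Qed.

Lemma nnegD x y : nneg x -> nneg y -> nneg (x + y).
Proof.
by move=> /forallP px /forallP py; apply/forallP => i; rewrite linearD addr_ge0 ?px ?py.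
Qed.

Lemma nnegZ (c : R) x : 0 <= c -> nneg x -> nneg (c *: x).
Proof.
by move=> c0 /forallP px; apply/forallP => i; rewrite linearZ mulr_ge0 ?px.
Qed.

Lemma nneg_sum (I : eqType) (r : seq I) (F : I -> V) :
  (forall i, i \in r -> nneg (F i)) -> nneg (\sum_(i <- r) F i).
Proof.
move=> pF; rewrite big_seq.
by apply: (big_ind nneg); [exact: nneg0 | exact: nnegD | exact: pF].
Qed.

Lemma nneg_anti x : nneg x -> nneg (- x) -> x = 0.
Proof.
move=> /forallP px /forallP nx.
rewrite [x](coord_basis (simple_basis hDelta) (memvf x)) big1 // => i _.
suff -> : coord Delta i x = 0 by rewrite scale0r.
by apply/le_anti; rewrite px andbT -oppr_ge0 -linearN nx.
Qed.

(** The opposite of one summand is the sum of the others, so that summand and its opposite both lie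
    in the cone, which is pointed. *)
Lemma nneg_sum_eq0 (I : eqType) (r : seq I) (F : I -> V) :
  (forall i, i \in r -> nneg (F i)) -> \sum_(i <- r) F i = 0 ->
  forall i, i \in r -> F i = 0.
Proof.
move=> pF F0 i ir; apply: nneg_anti; first exact: pF.
move: F0; rewrite (big_rem i) //= => /eqP; rewrite addrC addr_eq0 => /eqP <-.
by apply: nneg_sum => j /mem_rem; exact: pF.
Qed.

Lemma nneg_scale (c : R) x : x != 0 -> nneg x -> nneg (c *: x) -> 0 <= c.
Proof.
move=> x0 px pcx; rewrite leNgt; apply/negP => c0.
have /eqP : c *: x = 0.
  by apply: nneg_anti => //; rewrite -scaleNr nnegZ // oppr_ge0 ltW.
by rewrite scaler_eq0 (negPf x0) (lt_eqF c0).
Qed.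

(** * Signs of roots *)

Lemma root_nz a : a \in Phi -> a != 0.
Proof. by apply: contraTneq => ->; exact: (root_neq0 hPhi). Qed.

Lemma root_opp a : a \in Phi -> - a \in Phi.
Proof. by move=> aP; have [] := (root_line hPhi aP (- a)).2 (or_intror erefl). Qed.

Lemma root_oppE a : (- a \in Phi) = (a \in Phi).
Proof. by apply/idP/idP => /root_opp; rewrite ?opprK. Qed.

Lemma root_scale a b (c : R) : a \in Phi -> b \in Phi -> b = c *: a ->
  b = a \/ b = - a.
Proof. by move=> aP bP e; apply/(root_line hPhi aP); split=> //; exists c. Qed.

Lemma root_reflection a b : a \in Phi -> b \in Phi -> t a b \in Phi.
Proof. by move=> aP bP; rewrite -(root_refl hPhi aP) in_imfset. Qed.

Lemma root_nneg_opp a : a \in Phi -> nneg (- a) = ~~ nneg a.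
Proof.
move=> aP; apply/idP/idP => [na|].
  by apply: contra (root_nz aP) => pa; rewrite (nneg_anti pa).
case: (simple_coord hDelta aP) => h.
  by case/negP; apply/forallP => i; rewrite natr_ge0 ?h.
by move=> _; apply/forallP => i; rewrite linearN natr_ge0 ?h.
Qed.

Lemma nneg_root_scale a b (c : R) : a \in Phi -> b \in Phi -> nneg a -> nneg b ->
  b = c *: a -> b = a.
Proof.
move=> aP bP pa pb /(root_scale aP bP)[] // e.
by move: pa; rewrite -[a]opprK -e root_nneg_opp // pb.
Qed.

Lemma simple_root a : a \in Delta -> a \in Phi.
Proof. exact: simple_sub. Qed.

Lemma coord_simple (i j : 'I_n) : coord Delta i Delta`_j = (j == i)%:R.
Proof. by rewrite coord_free // (basis_free (simple_basis hDelta)). Qed.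

Lemma simple_nneg a : a \in Delta -> nneg a.
Proof.
case/tnthP => j ->; apply/forallP => i.
by rewrite (tnth_nth 0) coord_simple ler0n.
Qed.

(** [t a] changes only the [a]-coordinate. If [t a b] is negative, the other coordinates of [b] are
    both nonnegative and nonpositive, so [b] is a multiple of [a]. *)
Lemma simple_reflection_nneg a b : a \in Delta -> b \in Phi -> nneg b ->
  b != a -> nneg (t a b).
Proof.
move=> aD bP pb; apply: contraNT; have aP := simple_root aD.
rewrite -root_nneg_opp ?root_reflection // => /forallP ntb.
have /tnthP[i ea] := aD; rewrite (tnth_nth 0) in ea.
apply/eqP/(@nneg_root_scale _ _ (coord Delta i b)) => //; first exact: simple_nneg.
rewrite [LHS](coord_basis (simple_basis hDelta) (memvf b)) (bigD1 i) //= -ea.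
rewrite big1 ?addr0 // => j ji.
suff -> : coord Delta j b = 0 by rewrite scale0r.
apply/le_anti; rewrite (forallP pb) andbT.
have aj : coord Delta j a = 0 by rewrite ea coord_simple eq_sym (negPf ji).
by move: (ntb j); rewrite reflectionE opprB linearB linearZ /= aj mulr0 sub0r oppr_ge0.
Qed.

(** * The Weyl group and inversion sets *)

(** In general [f^-1] on ['End(V)] is only a pseudo-inverse; the trivial kernel makes it a true
    inverse on the Weyl group. *)
Lemma weyl_lker f : weyl_group ip Phi f -> lker f == 0%VS.
Proof.
elim=> {f} [|a aP|f g _ /lker0P fI _ /lker0P gI|f _ /lker0_lfunVK fK]; apply/lker0P.
- by move=> x y; rewrite !id_lfunE.
- exact: inv_inj (reflectionK _ (root_nz aP)).
- by move=> x y; rewrite !comp_lfunE => /fI/gI.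
- exact: can_inj fK.
Qed.

Lemma weyl_root f x : weyl_group ip Phi f -> (f x \in Phi) = (x \in Phi).
Proof.
move=> fW; elim: fW x => {f} [|a aP|f g _ fE _ gE|f fW fE] x.
- by rewrite id_lfunE.
- apply/idP/idP => [h|]; last exact: root_reflection.
  by rewrite -(reflectionK ip (root_nz aP) x) root_reflection.
- by rewrite comp_lfunE fE gE.
- by rewrite -(fE (f^-1%VF x)) lker0_lfunVK // weyl_lker.
Qed.

Lemma weyl_inv_reflection a w x : a \in Phi -> weyl_group ip Phi w ->
  (t a \o w)^-1%VF x = w^-1%VF (t a x).
Proof.
move=> aP wW; have aW := weyl_refl ip aP; have tW := weyl_comp aW wW.
have wK := weyl_lker wW; have tK := weyl_lker tW.
apply: (lker0P tK); rewrite lker0_lfunVK // comp_lfunE lker0_lfunVK //.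
by rewrite reflectionK // root_nz.
Qed.

(** Trades the image of the negative roots for a sign test on [w^-1 x], the form in which inversions
    are handled below. *)
Lemma mem_inversions w x : weyl_group ip Phi w ->
  (x \in N w) = [&& x \in Phi, nneg x & nneg (- (w^-1%VF x))].
Proof.
move=> wW; have wK := weyl_lker wW.
have negE y : [forall i, coord Delta i y <= 0] = nneg (- y).
  by apply: eq_forallb => i; rewrite linearN oppr_ge0.
rewrite !inE /= -andbA; apply/and3P/and3P => -[xP px].
  case/imfsetP => y /=; rewrite !inE negE => /andP[yP ny] e.
  by split=> //; rewrite e lker0_lfunK.
move=> nx; split=> //; apply/imfsetP; exists (w^-1%VF x); last by rewrite lker0_lfunVK.
by rewrite !inE /= negE nx andbT -(weyl_root _ wW) lker0_lfunVK.
Qed.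


Lemma inversion_root w x : x \in N w -> x \in Phi.
Proof. by rewrite !inE -andbA => /and3P[]. Qed.

Lemma inversion_nneg w x : x \in N w -> nneg x.
Proof. by rewrite !inE -andbA => /and3P[]. Qed.

Lemma mem_fset_sep (K : choiceType) (A : {fset K}) (P : pred K) k :
  (k \in [fset z in A | P z]%fset) = (k \in A) && P k.
Proof. by rewrite !inE. Qed.

Lemma inversions_reflection_card w b : weyl_group ip Phi w -> b \in N w ->
  #|` N (t b \o w)%VF| =
  #|` [fset x in (N w `\ b)%fset | nneg (t b x) || nneg (- w^-1%VF (t b x))]%fset|.
Proof.
move=> wW bN; have := bN; rewrite mem_inversions // => /and3P[bP pb nb].
have tW := weyl_refl ip bP; have b0 := root_nz bP.
have tK := reflectionK ip b0; have tb := reflection_self ip b0.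
have tP x : (t b x \in Phi) = (x \in Phi) by rewrite weyl_root.
have gP x : (w^-1%VF x \in Phi) = (x \in Phi) by rewrite weyl_root //; apply: weyl_inv.
have mN' x : x \in N (t b \o w)%VF =
    [&& x \in Phi, nneg x & nneg (- w^-1%VF (t b x))].
  by rewrite mem_inversions ?weyl_inv_reflection //; apply: weyl_comp.
(* A collision between a reflected and an unreflected value would make [t b] of the unreflected root
   positive, against the choice made for it. *)
pose phi x := if nneg (t b x) then t b x else x.
have phi_inj : {in N (t b \o w)%VF &, injective phi}.
  move=> x y; rewrite !mN' /phi => /and3P[xP px _] /and3P[yP py _].
  case: ifP => tx; case: ifP => ty // e.
  - exact: (inv_inj tK).
  - by rewrite -e tK px in ty.
  - by rewrite e tK py in tx.
have /card_in_imfsetP/eqP <- := phi_inj; congr #|` _|; apply/fsetP => y.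
apply/imfsetP/idP => [[x /=]|].
  rewrite mN' => /and3P[xP px nx] ->; rewrite /phi mem_fset_sep in_fsetD1.
  case: ifP => tx.
    rewrite tK px andbT mem_inversions // tP xP tx nx !andbT.
    apply/eqP => e; move: px; rewrite -(tK x) e tb => pb'.
    by move: b0; rewrite (nneg_anti pb pb') eqxx.
  have xb : x != b.
    apply/eqP => e; move: nx; rewrite e tb linearN opprK => pgb.
    move: (nneg_anti pgb nb) => gb0; move: bP; rewrite -gP gb0.
    exact/negP/(root_neq0 hPhi).
  (* Here [t b x] is negative, so [<x, b> b = x - t b x] lies in the cone and [<x, b> >= 0]. Then
     [- w^-1 x] is [- w^-1 (t b x)] plus a nonnegative multiple of [- w^-1 b]. *)
  rewrite xb tx nx mem_inversions // xP px /= andbT.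
  have k0 : 0 <= pairing ip x b.
    apply: (@nneg_scale _ b) => //.
    have -> : pairing ip x b *: b = x + - t b x.
      by rewrite reflectionE opprB addrC subrK.
    by apply: nnegD => //; rewrite root_nneg_opp ?tP // tx.
  have -> : - w^-1%VF x = - w^-1%VF (t b x) + pairing ip x b *: - w^-1%VF b.
    by rewrite reflectionE linearB linearZ /= opprB scalerN addrAC subrr sub0r.
  by apply: nnegD => //; apply: nnegZ.
(* Surjectivity: the preimage of [y] is [t b y] when that is positive, and [y] itself otherwise. *)
rewrite mem_fset_sep in_fsetD1 mem_inversions // => /andP[/andP[yb /and3P[yP py ny]]].
have [ty _|/negbTE ty /= nty] := boolP (nneg (t b y)).
  by exists (t b y); rewrite /phi ?tK ?py // mN' tP yP ty tK ny.
by exists y; rewrite /phi ?ty // mN' yP py nty.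
Qed.

(** * Words, exchange and the number of inversions *)

Lemma inversions_id : N \1%VF = fset0.
Proof.
apply/fsetP => x; rewrite mem_inversions; last exact: weyl_id.
rewrite in_fset0; apply/negP => /and3P[xP px].
have -> : (\1%VF : 'End(V))^-1%VF x = x.
  have k1 : lker (\1%VF : 'End(V)) == 0%VS := weyl_lker (weyl_id ip Phi).
  by apply: (lker0P k1); rewrite lker0_lfunVK // id_lfunE.
by rewrite root_nneg_opp // px.
Qed.

(** For simple [a] the first alternative in [inversions_reflection_card] always holds, since [t a]
    keeps every other positive root positive. *)
Lemma card_inversions_simple w a : a \in Delta -> weyl_group ip Phi w ->
  a \in N w -> #|` N w| = #|` N (t a \o w)%VF|.+1.
Proof.
move=> aD wW aN; rewrite inversions_reflection_card // (cardfsD1 a) aN add1n.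
congr (#|` _|.+1); apply/fsetP => x; rewrite mem_fset_sep !in_fsetD1.
case: eqVneq => //= xa; case xN: (x \in N w) => //=.
by rewrite simple_reflection_nneg ?(inversion_root xN) ?(inversion_nneg xN).
Qed.

(** Here [a] is an inversion of [t a \o w], and the previous lemma applies to that element. *)
Lemma card_inversions_simpleN w a : a \in Delta -> weyl_group ip Phi w ->
  a \notin N w -> #|` N (t a \o w)%VF| = #|` N w|.+1.
Proof.
move=> aD wW aN; have aP := simple_root aD; have pa := simple_nneg aD.
have tW := weyl_comp (weyl_refl ip aP) wW; have a0 := root_nz aP.
rewrite (@card_inversions_simple _ a) //.
  by rewrite comp_lfunA reflection_comp // comp_lfun1l.
rewrite mem_inversions // aP pa weyl_inv_reflection // reflection_self //.
rewrite linearN opprK /=; move: aN; rewrite mem_inversions // aP pa /=.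
rewrite root_nneg_opp ?negbK // weyl_root //; exact: weyl_inv.
Qed.

Lemma word_prod_weyl s : {subset s <= Delta} -> weyl_group ip Phi (word_prod ip s).
Proof.
elim: s => [|a s IH] sD; first exact: weyl_id.
apply: weyl_comp; first by apply/weyl_refl/simple_root/sD/mem_head.
by apply: IH => x xs; apply: sD; rewrite inE xs orbT.
Qed.

Lemma word_prod_cat s1 s2 :
  word_prod ip (s1 ++ s2) = (word_prod ip s1 \o word_prod ip s2)%VF.
Proof. by elim: s1 => [|a s1 IH] /=; rewrite ?comp_lfun1l // IH comp_lfunA. Qed.

Lemma card_inversions_word s : {subset s <= Delta} ->
  (#|` N (word_prod ip s)| <= size s)%N.
Proof.
elim: s => [|a s IH] sD; first by rewrite inversions_id cardfs0.
have aD : a \in Delta by apply/sD/mem_head.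
have {}sD : {subset s <= Delta} by move=> x xs; apply: sD; rewrite inE xs orbT.
have wW := word_prod_weyl sD; have /= {}IH := IH sD.
have [aN|aN] := boolP (a \in N (word_prod ip s)).
  by rewrite ltnW // ltnS (leq_trans _ IH) // -ltnS -card_inversions_simple.
by rewrite card_inversions_simpleN.
Qed.

(** If [a] is the first letter [c], delete it. Otherwise [t c a] is an inversion of the product of
    the tail, and the deletion found there is carried back by conjugating with [t c]. *)
Lemma exchange s a : {subset s <= Delta} -> a \in N (word_prod ip s) ->
  exists2 s', {subset s' <= Delta} &
    (size s').+1 = size s /\ (t a \o word_prod ip s)%VF = word_prod ip s'.
Proof.
elim: s a => [|c s IH] a sD; first by rewrite inversions_id.
have cD : c \in Delta by apply/sD/mem_head.
have {}sD : {subset s <= Delta} by move=> x xs; apply: sD; rewrite inE xs orbT.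
have wW := word_prod_weyl sD; have cP := simple_root cD; have c0 := root_nz cP.
have tW := weyl_comp (weyl_refl ip cP) wW.
rewrite mem_inversions // => /and3P[aP pa]; rewrite weyl_inv_reflection // => na.
have [ac|ac] := eqVneq a c.
  exists s => //; split=> //=.
  by rewrite ac comp_lfunA reflection_comp // comp_lfun1l.
have [||s' s'D [s's e]] := IH (t c a) => //.
  by rewrite mem_inversions // root_reflection // simple_reflection_nneg.
exists (c :: s').
  by move=> x; rewrite inE => /orP[/eqP->|/s'D].
split=> /=; first by rewrite s's.
by rewrite -e -reflection_conj // !comp_lfunA reflection_comp // comp_lfun1l.
Qed.

(** Built letter by letter: a letter that would lower the number of inversions is not prepended but
    absorbed by [exchange]. *)
Lemma reduced_word s : {subset s <= Delta} -> exists2 s', {subset s' <= Delta} &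
  size s' = #|` N (word_prod ip s)| /\ word_prod ip s' = word_prod ip s.
Proof.
elim: s => [|a s IH] sD; first by exists [::] => //; rewrite inversions_id cardfs0.
have aD : a \in Delta by apply/sD/mem_head.
have {}sD : {subset s <= Delta} by move=> x xs; apply: sD; rewrite inE xs orbT.
have wW := word_prod_weyl sD; have [r rD [rs re]] := IH sD => /=.
have [aN|aN] := boolP (a \in N (word_prod ip s)).
  have [|r' r'D [r's e]] := @exchange r a rD; first by rewrite re.
  exists r' => //; split; last by rewrite -e re.
  by apply: succn_inj; rewrite r's rs; apply: card_inversions_simple.
exists (a :: r) => /=; first by move=> x; rewrite inE => /orP[/eqP->|/rD].
by rewrite rs re card_inversions_simpleN.
Qed.

(** * Generation of the Weyl group by simple reflections *)

(** Expanding the second argument of [ip b b > 0] in the simple basis, some term is positive, and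
    its coordinate is nonnegative. *)
Lemma simple_pairing_gt0 b : b \in Phi -> nneg b ->
  exists2 a, a \in Delta & 0 < pairing ip b a.
Proof.
move=> bP pb; have b0 := root_nz bP; have := ip_gt0 ip b0.
rewrite {2}[b](coord_basis (simple_basis hDelta) (memvf b)) linear_sum /=.
move=> h; have /existsP[i hi] : [exists i : 'I_n, 0 < ip b (coord Delta i b *: Delta`_i)].
  apply: contraTT h; rewrite negb_exists => /forallP nh; rewrite -leNgt.
  by apply: sumr_le0 => i _; rewrite leNgt nh.
have iD : Delta`_i \in Delta by rewrite mem_nth ?size_tuple.
exists Delta`_i => //; rewrite pairing_gt0 ?root_nz ?simple_root //.
move: hi; rewrite linearZr_LR /=.
have := forallP pb i; rewrite le_eqVlt => /orP[/eqP <-|ci]; first by rewrite mul0r ltxx.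
by rewrite pmulr_rgt0.
Qed.

Definition height x : R := \sum_i coord Delta i x.

Lemma heightB x y (c : R) : height (x - c *: y) = height x - c * height y.
Proof.
rewrite /height mulr_sumr -sumrB; apply: eq_bigr => i _.
by rewrite linearB linearZ.
Qed.

Lemma height_simple a : a \in Delta -> height a = 1.
Proof.
case/tnthP => i ->; rewrite (tnth_nth 0) /height (bigD1 i) //= coord_simple eqxx.
by rewrite big1 ?addr0 // => j ji; rewrite coord_simple eq_sym (negPf ji).
Qed.

(** Induction on height: some simple [a] has [<b, a> > 0], hence at least 1 by integrality, so
    [t a b] is lower by at least 1, and [t b] is the conjugate of its reflection by [t a]. *)
Lemma simple_word_reflection b : b \in Phi ->
  exists s, simple_word ip Delta (t b) s.
Proof.
wlog pb : b / nneg b => [hw bP|bP].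
  have [pb|nb] := boolP (nneg b); first exact: hw.
  have [||s [sD e]] := hw (- b); rewrite ?root_oppE ?root_nneg_opp //.
  exists s; split=> //; rewrite -e; apply/lfunP => x.
  rewrite !reflectionE /pairing linearNr linearNl linearNr opprK.
  by rewrite mulrN mulNr scaleNr scalerN opprK.
(* [height] takes values in [R], so the induction runs on a natural number above it. *)
have [m hm] : exists m : nat, height b < m%:R.
  exists (Num.bound (height b)); apply: archi_boundP.
  by apply: sumr_ge0 => i _; apply: (forallP pb).
elim: m b pb bP hm => [|m IH] b pb bP hm.
  have : 0 <= height b by apply: sumr_ge0 => i _; apply: (forallP pb).
  by rewrite leNgt hm.
have [a aD hab] := simple_pairing_gt0 bP pb; have aP := simple_root aD.
have [->|ba] := eqVneq b a.
  exists [:: a]; split; first by move=> x; rewrite inE => /eqP ->.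
  by rewrite /= comp_lfun1r.
have [|||s [sD e]] := IH (t a b).
- exact: simple_reflection_nneg.
- exact: root_reflection.
- rewrite reflectionE heightB (height_simple aD) mulr1.
  have : 1 <= pairing ip b a.
    have := norm_intr_ge1 (root_int hPhi aP bP) (lt0r_neq0 hab).
    by rewrite gtr0_norm.
  move: hm; rewrite -natr1; lra.
exists (a :: s ++ [:: a]); split.
  by move=> x; rewrite inE mem_cat inE => /or3P[/eqP->|/sD|/eqP->].
rewrite /= word_prod_cat /= comp_lfun1r -e -reflection_conj ?root_nz //.
rewrite !comp_lfunA reflection_comp ?root_nz // comp_lfun1l -comp_lfunA.
by rewrite reflection_comp ?root_nz // comp_lfun1r.
Qed.

Lemma word_prod_rev s : {subset s <= Delta} ->
  (word_prod ip s \o word_prod ip (rev s) = \1)%VF.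
Proof.
elim: s => [|a s IH] sD; first by rewrite /= comp_lfun1l.
have aD : a \in Delta by apply/sD/mem_head.
have {}sD : {subset s <= Delta} by move=> x xs; apply: sD; rewrite inE xs orbT.
rewrite rev_cons -cats1 word_prod_cat /= comp_lfun1r.
rewrite -comp_lfunA [X in (_ \o X)%VF]comp_lfunA IH // comp_lfun1l.
by rewrite reflection_comp // root_nz // simple_root.
Qed.

Lemma weyl_simple_word w : weyl_group ip Phi w -> exists s, simple_word ip Delta w s.
Proof.
elim=> {w} [|a aP|f g _ [s [sD ->]] _ [r [rD ->]]|f fW [s [sD e]]].
- by exists [::].
- exact: simple_word_reflection.
- exists (s ++ r); split; last by rewrite word_prod_cat.
  by move=> x; rewrite mem_cat => /orP[/sD|/rD].
(* [f^-1] and the product of [rev s] are both right inverses of the injective [f]. *)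
- exists (rev s); split; first by move=> x; rewrite mem_rev => /sD.
  have fK := weyl_lker fW; apply/lfunP => x; apply: (lker0P fK).
  by rewrite lker0_lfunVK // {1}e -comp_lfunE word_prod_rev // id_lfunE.
Qed.

(** No word is shorter than the number of inversions, and [reduced_word] attains it; so the minimum
    exists and [xget] does not fall back on its default. *)
Lemma length_card_inversions w : weyl_group ip Phi w ->
  Defs.length ip Delta w = #|` N w|.
Proof.
move=> /weyl_simple_word[s [sD ->]]; have [r rD [rs re]] := reduced_word sD.
apply: xget_unique => [|k [[s1 [s1D e1] <-] h1]].
  split; first by exists r; rewrite ?rs //; split.
  by move=> s1 [s1D ->]; apply: card_inversions_word.
apply/eqP; rewrite eqn_leq {2}e1 card_inversions_word // andbT -rs.
by apply: h1; split.
Qed.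

(** * Bruhat inversions and extremality *)

(** By the cardinality formula, the length drops by exactly one when the subset [B] of the other
    inversions [A] is all of [A]. *)
Lemma Bruhat_inversionP w b : weyl_group ip Phi w -> b \in N w ->
  (Bruhat_inversion ip Phi Delta w b <->
   forall x, x \in N w -> x != b -> nneg (t b x) || nneg (- w^-1%VF (t b x))).
Proof.
move=> wW bN; have bP := inversion_root bN.
have tW := weyl_comp (weyl_refl ip bP) wW.
rewrite /Bruhat_inversion !length_card_inversions // inversions_reflection_card //.
have bpos : b \in positive_roots Phi Delta.
  by move: bN; rewrite in_fsetI => /andP[].
rewrite (cardfsD1 b (N w)) bN add1n.
set A := (N w `\ b)%fset; set B := [fset x in A | _]%fset.
have BA : (B `<=` A)%fset by apply/fsubsetP => x; rewrite mem_fset_sep => /andP[].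
split=> [[_ [BA_card]]|h].
  have /eqP BE : B == A by rewrite -(fsubset_leqif_cards BA) BA_card.
  move=> x xN xb.
  have : x \in B by rewrite BE in_fsetD1 xb.
  by rewrite mem_fset_sep => /andP[].
split=> //; suff -> : B = A by [].
apply/eqP; rewrite eqEfsubset BA /=.
apply/fsubsetP => x xA; rewrite mem_fset_sep xA /=.
by move: xA; rewrite in_fsetD1 => /andP[xb xN]; apply: h.
Qed.

Lemma Bruhat_cone_extremal w b (a : V -> R) : weyl_group ip Phi w -> b \in N w ->
  Bruhat_inversion ip Phi Delta w b -> (forall g, g \in N w -> 0 <= a g) ->
  b = \sum_(g <- enum_fset (N w)) a g *: g ->
  forall g, g \in N w -> a g = (b == g)%:R.
Proof.
move=> wW bN /(Bruhat_inversionP wW bN) hb a0 be.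
have bP := inversion_root bN; have pb := inversion_nneg bN; have b0 := root_nz bP.
have nub : nneg (- w^-1%VF b) by move: bN; rewrite mem_inversions // => /and3P[].
(* At [g = b] everything goes into [c]. When [t b g] is not positive, the Bruhat criterion makes
   [w^-1 (t b g)] negative, so [g] needs no shift. *)
pose p g := if g == b then 0 else if nneg (t b g) then t b g else g.
pose c g : R := if g == b then 1 else if nneg (t b g) then pairing ip g b else 0.
have pc g : g = p g + c g *: b.
  rewrite /p /c; case: eqVneq => [->|_]; first by rewrite add0r scale1r.
  by case: ifP => _; rewrite ?reflectionE ?subrK // scale0r addr0.
have pp g : g \in N w -> nneg (p g).
  move=> gN; rewrite /p; case: eqP => _; first exact: nneg0.
  by case: ifP => // _; exact: inversion_nneg gN.
have np g : g \in N w -> nneg (- w^-1%VF (t b (p g))).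
  move=> gN; rewrite /p; case: eqVneq => [_|gb]; first by rewrite !linear0 nneg0.
  case: ifPn => [_|ng]; last by have := hb g gN gb; rewrite (negPf ng).
  by rewrite reflectionK //; move: gN; rewrite mem_inversions // => /and3P[].
pose S := \sum_(g <- enum_fset (N w)) a g *: p g.
pose C := 1 - \sum_(g <- enum_fset (N w)) a g * c g.
have CS : C *: b = S.
  rewrite /C scalerBl scale1r {1}be scaler_suml /S -sumrB; apply: eq_bigr => g _.
  by rewrite -scalerA -scalerBr; congr (_ *: _); rewrite {1}(pc g) addrK.
have C_ge0 : 0 <= C.
  apply: (nneg_scale b0 pb); rewrite CS; apply: nneg_sum => g gN.
  by apply: nnegZ; [exact: a0 | exact: pp].
(* Applying [- w^-1] after [t b] sends [C *: b] to [- C] times the cone vector [- w^-1 b], and every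
   [p g] into the cone. *)
have C_le0 : 0 <= - C.
  have ub0 : - w^-1%VF b != 0.
    rewrite oppr_eq0; apply: contra b0 => /eqP ub.
    by rewrite -(lker0_lfunVK (weyl_lker wW) b) ub linear0.
  apply: (nneg_scale ub0 nub).
  have -> : - C *: - w^-1%VF b = - w^-1%VF (t b (C *: b)).
    have e : w^-1%VF (C *: - b) = - (C *: w^-1%VF b) by rewrite scalerN linearN linearZ.
    by rewrite linearZ /= reflection_self // e opprK scaleNr scalerN opprK.
  rewrite CS /S !linear_sum /=; apply: nneg_sum => g gN.
  rewrite !linearZ /=; apply: nnegZ; [exact: a0 | exact: np].
have C0 : C = 0 by apply/le_anti; rewrite C_ge0 andbT -oppr_ge0.
have S0 : S = 0 by rewrite -CS C0 scale0r.
have az g : g \in N w -> g != b -> a g = 0.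
  move=> gN gb; have /eqP : a g *: p g = 0.
    apply: (nneg_sum_eq0 _ S0) => // x xN.
    by apply: nnegZ; [exact: a0 | exact: pp].
  rewrite scaler_eq0 => /orP[/eqP // | /eqP].
  (* For [g != b], [p g] is [g] or [t b g], hence nonzero. *)
  have gP := inversion_root gN.
  rewrite /p (negPf gb); case: ifP => _ e; have := root_nz gP; last by rewrite e eqxx.
  by rewrite -(reflectionK ip b0 g) e linear0 eqxx.
move=> g gN; have [<-|bg] := eqVneq b g; last by rewrite az // eq_sym.
(* Only the [b]-term of the relation survives, leaving [(a b - 1) *: b = 0]. *)
apply/eqP; rewrite -subr_eq0; apply: contraTT b0; rewrite negbK => ab.
have /eqP : (a b - 1) *: b = 0.
  rewrite scalerBl scale1r {3}be (bigD1_seq b) ?fset_uniq //= big1_seq ?addr0 ?subrr //.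
  by move=> x /andP[xb xN]; rewrite az // scale0r.
by rewrite scaler_eq0 (negPf ab).
Qed.

Lemma non_Bruhat_decomposition w b : weyl_group ip Phi w -> b \in N w ->
  ~ Bruhat_inversion ip Phi Delta w b ->
  exists x y, [/\ x \in N w, y \in N w, x <> y, 0 < pairing ip x b &
    pairing ip x b *: b = x + y].
Proof.
move=> wW bN nB; have bP := inversion_root bN; have pb := inversion_nneg bN.
have [x [xN xb nt nu]] : exists x, [/\ x \in N w, x != b,
    ~~ nneg (t b x) & ~~ nneg (- w^-1%VF (t b x))].
  apply: contrapT => nx; apply: nB; apply/Bruhat_inversionP => // x xN xb.
  apply: contrapT => /negP; rewrite negb_or => /andP[nt nu]; apply: nx.
  by exists x.
have xP := inversion_root xN; have px := inversion_nneg xN.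
have tP := root_reflection bP xP; have uP : w^-1%VF (t b x) \in Phi.
  by rewrite weyl_root //; apply: weyl_inv.
have yN : - t b x \in N w.
  rewrite mem_inversions // root_opp // root_nneg_opp // nt linearN opprK /=.
  by move: nu; rewrite root_nneg_opp // negbK.
have e : pairing ip x b *: b = x + - t b x by rewrite reflectionE opprB addrC subrK.
exists x, (- t b x); split=> //.
  (* Equality would make [x] a multiple of [b]; two positive roots on one line coincide, but
     [x != b]. *)
  move=> xy; move: e; rewrite -xy -mulr2n -scaler_nat => e.
  case/eqP: xb; apply: (@nneg_root_scale _ _ (pairing ip x b / 2)) => //.
  by rewrite mulrC -scalerA e scalerA mulVf ?scale1r // pnatr_eq0.
(* The pairing is nonnegative because [x + y] lies in the cone; if it vanished, [t b x = x] would be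
   positive. *)
rewrite lt_neqAle; apply/andP; split; last first.
  apply: (nneg_scale (root_nz bP) pb); rewrite e; apply: nnegD => //.
  exact: inversion_nneg yN.
by apply: contra nt => /eqP k0; rewrite reflectionE -k0 scale0r subr0.
Qed.

(** * Integrality bounds on pairings *)

Lemma root_pairing_lt4 a b : a \in Phi -> b \in Phi -> a != b -> a != - b ->
  pairing ip a b * pairing ip b a < 4.
Proof.
move=> aP bP ab aNb; apply: strict_Cauchy_Schwarz; rewrite ?root_nz // => c.
apply/eqP => /(root_scale aP bP)[] e; first by rewrite e eqxx in ab.
by rewrite e opprK eqxx in aNb.
Qed.

(** Both pairings are positive integers with product below 4, so each is at most 3; if they are
    equal, their square is below 4 and they are 1. *)
Lemma root_pairing_bounds a b : a \in Phi -> b \in Phi -> a != b -> a != - b ->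
  0 < pairing ip a b ->
  exists2 m : nat, pairing ip a b = m%:R & m \in [:: 1; 2; 3]%N /\
    (pairing ip a b = pairing ip b a -> m = 1%N).
Proof.
move=> aP bP ab aNb k0; have h := root_pairing_lt4 aP bP ab aNb.
have k'0 : 0 < pairing ip b a by rewrite pairing_gt0C ?root_nz.
have k'1 : 1 <= pairing ip b a.
  by have := norm_intr_ge1 (root_int hPhi aP bP) (lt0r_neq0 k'0); rewrite gtr0_norm.
have /natrP[m km] : pairing ip a b \is a Num.nat.
  by rewrite natrEint (root_int hPhi) // ltW.
exists m => //; rewrite km in h k0 *; rewrite ltr0n in k0.
have m4 : (m < 4)%N.
  by rewrite -(ltr_nat R); apply: le_lt_trans h; rewrite ler_peMr // ler0n.
split; first by move: k0 m4; rewrite !inE; case: m {km h} => [|[|[|[|]]]].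
move=> e; move: h; rewrite -e -natrM ltr_nat.
by move: k0; case: m {km e m4} => [|[|m]] // _; rewrite ltnNge (@leq_mul 2 2).
Qed.

End RootSystem.

(** * The equivalences *)

Theorem theorem2p17 (R : realType) (V : vectType R) (ip : {dot V for idfun})
    (Phi : {fset V}) (n : nat) (Delta : n.-tuple V) (w : 'End(V)) (beta : V)
    (hPhi : root_system ip Phi) (hDelta : simple_roots Phi Delta)
    (hw : weyl_group ip Phi w) (hbeta : beta \in inversions Phi Delta w) :
  let inv := inversions Phi Delta w in
  let c1 := non_Bruhat_inversion ip Phi Delta w beta in
  let c2 := exists a : V -> R,
    [/\ forall g, g \in inv -> 0 <= a g,
        beta = \sum_(g <- enum_fset inv) a g *: g
      & exists2 g, g \in inv & a g <> (beta == g)%:R] in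
  let c3 := exists g1 g2 : V, exists a1 a2 : R,
    [/\ g1 \in inv, g2 \in inv, g1 <> g2, 0 < a1 /\ 0 < a2
      & beta = a1 *: g1 + a2 *: g2] in
  let c4 := exists g1 g2 : V, exists m : nat,
    [/\ g1 \in inv, g2 \in inv, g1 <> g2, m \in [:: 1; 2; 3]%N
      & beta = m%:R^-1 *: (g1 + g2)] in
  let c5 := exists g1 g2 : V,
    [/\ g1 \in inv, g2 \in inv & beta = g1 + g2] in
  [/\ c1 <-> c2, c1 <-> c3 & c1 <-> c4] /\
  (simply_laced ip Phi -> [/\ c1 <-> c5, c2 <-> c5, c3 <-> c5 & c4 <-> c5]).
Proof.
move=> inv c1 c2 c3 c4 c5; have bP := inversion_root hbeta.
have pairing_data : c1 -> exists x y (m : nat), [/\ x \in inv, y \in inv, x <> y,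
    m \in [:: 1; 2; 3]%N & m%:R *: beta = x + y /\
    (simply_laced ip Phi -> m = 1%N)].
  case=> _ nB.
  have [x [y [xN yN xy k0 e]]] := non_Bruhat_decomposition hPhi hDelta hw hbeta nB.
  have xP := inversion_root xN; have px := inversion_nneg xN.
  have pb := inversion_nneg hbeta.
  (* [x = beta] would turn the relation into [2 beta = beta + y], forcing [y = x]. *)
  have xb : x != beta.
    apply/eqP => xb; apply: xy; move: e; rewrite xb pairing_self ?(root_nz hPhi) //.
    by rewrite scaler_nat mulr2n => /addrI.
  have xNb : x != - beta.
    apply/eqP => xb'; move: px.
    by rewrite xb' (root_nneg_opp hPhi hDelta) // pb.
  have [m km [m3 m1]] := root_pairing_bounds hPhi xP bP xb xNb k0.
  exists x, y, m; split=> //; split; first by rewrite -km.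
  by move=> sl; apply/m1/sl.
have c14 : c1 -> c4.
  case/pairing_data => x [y [m [xN yN xy m3 [e _]]]]; exists x, y, m; split=> //.
  by rewrite -e scalerA mulVf ?scale1r // pnatr_eq0; case: m m3 {e}.
have c43 : c4 -> c3.
  case=> x [y [m [xN yN xy m3 e]]]; exists x, y, (m%:R^-1), (m%:R^-1).
  have m0 : 0 < m%:R^-1 :> R by rewrite invr_gt0 ltr0n; case: m m3 {e}.
  by split=> //; rewrite -scalerDr.
have c32 : c3 -> c2.
  case=> x [y [a1 [a2 [xN yN xy [a1_gt0 a2_gt0] e]]]].
  have sumE z (c : R) : z \in inv ->
      \sum_(g <- enum_fset inv) ((g == z)%:R * c) *: g = c *: z.
    move=> zN; rewrite (bigD1_seq z) ?fset_uniq //= eqxx mul1r big1 ?addr0 //.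
    by move=> g /negPf ->; rewrite mul0r scale0r.
  exists (fun g => (g == x)%:R * a1 + (g == y)%:R * a2); split.
  - by move=> g _; rewrite addr_ge0 // mulr_ge0 ?ler0n // ltW.
  - by under eq_bigr do rewrite scalerDl; rewrite big_split /= !sumE.
  (* The coefficient that differs from the Kronecker delta is the one at whichever of the two roots
     is not [beta]. *)
  - have [xb|xb] := eqVneq beta x.
      exists y => //; rewrite xb eqxx eq_sym (introF eqP xy) mul0r add0r mul1r.
      by move=> a20; rewrite a20 ltxx in a2_gt0.
    exists x => //; rewrite (negPf xb) eqxx (introF eqP xy) mul0r addr0 mul1r.
    by move=> a10; rewrite a10 ltxx in a1_gt0.
have c21 : c2 -> c1.
  case=> a [a0 e [g gN ag]]; split=> // B.
  exact/ag/(Bruhat_cone_extremal hPhi hDelta hw hbeta B a0 e gN).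
have e12 : c1 <-> c2 by split=> [/c14/c43/c32|].
have e13 : c1 <-> c3 by split=> [/c14/c43|/c32/c21].
have e14 : c1 <-> c4 by split=> [|/c43/c32/c21].
split=> // sl.
suff e15 : c1 <-> c5.
  by split; [|apply: iff_trans (iff_sym e12) e15|apply: iff_trans (iff_sym e13) e15
            |apply: iff_trans (iff_sym e14) e15].
split=> [/pairing_data[x [y [m [xN yN _ _ [e m1]]]]]|[x [y [xN yN e]]]].
  by exists x, y; split=> //; rewrite -e m1 // scale1r.
apply/e14; exists x, y, 1%N; split=> //; last by rewrite invr1 scale1r.
(* Condition (5) does not ask for distinct roots. If they were equal, [beta = 2 x] would be a
   positive root on the line of [x], so [beta = x] and [x = 0]. *)
move=> xy; move: e; rewrite -xy -mulr2n -scaler_nat => e.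
have xP := inversion_root xN; have x0 := root_nz hPhi xP.
have xb : beta = x.
  have px := inversion_nneg xN; have pb := inversion_nneg hbeta.
  exact: (nneg_root_scale hPhi hDelta xP bP px pb e).
move: e; rewrite xb scaler_nat mulr2n -[LHS]addr0 => /addrI/esym x00.
by rewrite x00 eqxx in x0.
Qed.
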